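(* Let $\{\pi^k\}_{k\ge0}$ be generated by softmax policy gradient (softmax PG) with any constant step size $\eta_k=\eta>0$, and let $\sigma\in(0,1)$ be given. Then there exists a time $T(\sigma)$ such that for all $k\ge T(\sigma)$, $$V^*(\rho)-V^k(\rho)\ge\frac1k\cdot\frac{\tilde\rho^3(1-\sigma)(1-\gamma)}{2|\mathcal{A}|^3}\left\|\frac{1}{d_\rho^*}\right\|_\infty^{-1}\left(\exp\left(\frac{2\eta}{(1-\gamma)^2}\right)-1\right)^{-1}.$$
   Context: MDP: a tuple $(\mathcal{S},\mathcal{A},P,r,\gamma)$ with finite state space $\mathcal{S}$, finite action space $\mathcal{A}$, transition probabilities $P(s'|s,a)$, reward $r:\mathcal{S}\times\mathcal{A}\to[0,1]$ and discount factor $\gamma\in[0,1)$. $\Delta(\mathcal{A})$, $\Delta(\mathcal{S})$ denote probability simplices; a policy is $\pi=(\pi(\cdot|s))_{s\in\mathcal{S}}$ with $\pi(\cdot|s)\in\Delta(\mathcal{A})$. Values: $V^\pi(s)=\mathbb{E}[\sum_{t\ge0}\gamma^t r(s_t,a_t)\mid s_0=s,\pi]$, $Q^\pi(s,a)=\mathbb{E}[\sum_{t\ge0}\gamma^t r(s_t,a_t)\mid s_0=s,a_0=a,\pi]$, $A^\pi=Q^\pi-V^\pi$, $V^\pi(\rho)=\mathbb{E}_{s\sim\rho}[V^\pi(s)]$. $V^*,Q^*$ are the optimal values, $A^*(s,a)=Q^*(s,a)-V^*(s)$, $\mathcal{A}_s^*=\arg\max_aA^*(s,a)$; an optimal policy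 is a policy whose state value is $V^*$. It is assumed that $\tilde{\mathcal S}=\{s:\mathcal{A}_s^*\neq\mathcal{A}\}$ is nonempty (not every policy is optimal). Visitation measure: $d_\rho^\pi(s)=(1-\gamma)\mathbb{E}[\sum_{t\ge0}\gamma^t\mathbf{1}\{s_t=s\}\mid s_0\sim\rho,\pi]$; $d_\rho^*=d_\rho^{\pi^*}$ for a fixed optimal policy $\pi^*$. For policies $\pi^k$, write $V^k,A^k,d_\mu^k$ for $V^{\pi^k},A^{\pi^k},d_\mu^{\pi^k}$. $1/d_\rho^*$ is entrywise, $\|\cdot\|_\infty$ is the maximum absolute entry. Distributions: $\mu\in\Delta(\mathcal{S})$ is fixed with $\min_s\mu(s)>0$; $\rho\in\Delta(\mathcal{S})$ is arbitrary with $\tilde\rho=\min_s\rho(s)>0$. Softmax PG: start from any softmax policy $\pi^0$ (so $\pi^0(a|s)\propto\exp(\theta^0_{s,a})$, all entries positive) and iterate $$\pi^{k+1}(a|s)=\frac{\pi^k(a|s)\exp\left(\eta_s^k\,\pi^k(a|s)A^k(s,a)\right)}{\sum_{a'}\pi^k(a'|s)\exp\left(\eta_s^k\,\pi^k(a'|s)A^k(s,a')\right)},\qquad \eta_s^k=\frac{\eta_k}{1-\gamma}d_\mu^k(s).$$ *)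

(* Defs.v *)
From mathcomp Require Import all_boot all_order all_algebra.
From mathcomp Require Import all_classical all_reals all_analysis.

Set Implicit Arguments.
Unset Strict Implicit.
Unset Printing Implicit Defensive.

Import Order.TTheory GRing.Theory Num.Theory.
Import numFieldNormedType.Exports.

Local Open Scope classical_set_scope.
Local Open Scope ring_scope.

Definition is_dist (R : realType) (T : finType) (p : T -> R) : Prop :=
  (forall x, 0 <= p x) /\ \sum_x p x = 1.

(* The idle value 1 is harmless: the entries of a distribution are at most 1
   and its support type is nonempty. *)
Definition min_entry (R : realType) (T : finType) (p : T -> R) : R :=
  \big[Order.min/1]_x p x.

Definition norm_infty (R : realType) (T : finType) (f : T -> R) : R :=
  \big[Order.max/0]_x `|f x|.

Record mdp (R : realType) (S A : finType) := Mdp {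
  trans : S -> A -> S -> R;
  reward : S -> A -> R;
  discount : R;
  transP : forall s a, is_dist (trans s a);
  rewardP : forall s a, 0 <= reward s a <= 1;
  discountP : 0 <= discount < 1
}.

Section MDP.
Variables (R : realType) (S A : finType) (M : mdp R S A).
Implicit Types (pi : S -> A -> R) (nu : S * A -> R) (rho : S -> R).

Definition is_policy pi : Prop := forall s, is_dist (pi s).

(* The law of (s_0, a_0, ..., s_n, a_n) when (s_0, a_0) has law nu and
   a_t ~ pi(.|s_t) for t > 0; h t is the pair (s_t, a_t). *)
Definition path_law pi nu (n : nat) (h : {ffun 'I_n.+1 -> S * A}) : R :=
  nu (h ord0) *
  \prod_(t < n)
    (let: (s, a) := h (widen_ord (leqnSn n) t) in
     let: (s', a') := h (lift ord0 t) in
     trans M s a s' * pi s' a').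

Definition path_exp pi nu (n : nat) (f : {ffun 'I_n.+1 -> S * A} -> R) : R :=
  \sum_(h : {ffun 'I_n.+1 -> S * A}) path_law pi nu h * f h.

(* E[sum_{t >= 0} gamma^t f(s_t, a_t)], as the limit of the expectations of the
   truncated sums; f takes finitely many values, so this agrees with the
   expectation of the infinite sum by dominated convergence. *)
Definition disc_exp pi nu (f : S -> A -> R) : R :=
  lim ((fun n : nat => path_exp pi nu (fun h : {ffun 'I_n.+1 -> S * A} =>
          \sum_(t < n.+1) discount M ^+ t * f (h t).1 (h t).2)) @ \oo).

Definition start_dist pi rho : S * A -> R := fun x => rho x.1 * pi x.1 x.2.

Definition V pi (s : S) : R :=
  disc_exp pi (start_dist pi (fun s0 => (s0 == s)%:R)) (reward M).

Definition Q pi (s : S) (a : A) : R :=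
  disc_exp pi (fun x => (x == (s, a))%:R) (reward M).

Definition Adv pi (s : S) (a : A) : R := Q pi s a - V pi s.

Definition visitation pi rho (s : S) : R :=
  (1 - discount M) *
  disc_exp pi (start_dist pi rho) (fun s' _ => (s' == s)%:R).

Definition avg rho (v : S -> R) : R := \sum_s rho s * v s.

Definition Vstar (s : S) : R := sup [set V pi s | pi in is_policy].

Definition Qstar (s : S) (a : A) : R := sup [set Q pi s a | pi in is_policy].

Definition Astar (s : S) (a : A) : R := Qstar s a - Vstar s.

Definition opt_actions (s : S) : {set A} :=
  [set a | [forall b, Astar s b <= Astar s a]]%SET.

Definition nontrivial_states : {set S} :=
  [set s | opt_actions s != [set: A]%SET]%SET.

Definition is_optimal pi : Prop :=
  is_policy pi /\ forall s, V pi s = Vstar s.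

Definition is_softmax pi : Prop :=
  exists theta : S -> A -> R, forall s a,
    pi s a = expR (theta s a) / \sum_b expR (theta s b).

Definition pg_step (eta : R) (mu : S -> R) pi (s : S) (a : A) : R :=
  let eta_s := eta / (1 - discount M) * visitation pi mu s in
  let w b := pi s b * expR (eta_s * pi s b * Adv pi s b) in
  w a / \sum_b w b.

Definition softmax_pg (eta : nat -> R) (mu : S -> R) (pi : nat -> S -> A -> R) :
    Prop :=
  is_softmax (pi 0%N) /\
  forall k s a, pi k.+1 s a = pg_step (eta k) mu (pi k) s a.

End MDP.

(* Main.v *)
Require Import Defs.
From mathcomp Require Import all_boot all_order all_algebra.
From mathcomp Require Import all_classical all_reals all_analysis.
From mathcomp Require Import ring lra.

Set Implicit Arguments.
Unset Strict Implicit.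
Unset Printing Implicit Defensive.

Import Order.TTheory GRing.Theory Num.Theory.
Import numFieldNormedType.Exports.
Local Open Scope ring_scope.

(* Write d_k = V*(rho) - V^k(rho), L = eta / (1 - gamma)^2 and r = min rho.
   With u_a = pi^k(a|s) A^k(s,a), which sums to 0 over a, the multiplicative
   update gives
     sum_a pi^{k+1}(a|s) A^k(s,a) <= (1 - gamma) (e^{2L} - 1) sum_a u_a^2,
   and u_a <= pi^k(a|s) d_k / r because Q^k <= V*, so the sum of squares is at
   most 2 (d_k / r)^2.  By the Bellman equation for V^{k+1} - V^k,
   d_k - d_{k+1} <= C d_k^2 with C = 2 (e^{2L} - 1) / r^2.
   An update shrinks each probability by a factor at most e^{2L}, so also
   d_{k+1} >= c d_k for some c > 0.  Hence 1/d_k grows at most like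
   C k / (1 - eps) for every eps > 0: when C d_k > eps the second bound keeps
   1/d_{k+1} below C / (c eps), so d_k -> 0 is not needed. *)

(** * Limits and averages of finite families *)

Lemma cvg_linear_combination (R : realType) (T : finType) (c l : T -> R)
    (u : nat -> T -> R) :
  (forall x, (fun n => u n x) @ \oo --> l x)%classic ->
  ((fun n => \sum_x c x * u n x) @ \oo --> (\sum_x c x * l x))%classic.
Proof.
move=> hu; apply: cvg_big => [|x _]; first exact: add_continuous.
by apply: cvgM; [exact: cvg_cst|exact: hu].
Qed.

Lemma dist_entry_le1 (R : realType) (T : finType) (p : T -> R) (x : T) :
  is_dist p -> p x <= 1.
Proof.
move=> [p_ge0 <-]; rewrite (bigD1 x) //= lerDl.
by apply: sumr_ge0 => y _; exact: p_ge0.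
Qed.

Lemma dist_average_le (R : realType) (T : finType) (p f : T -> R) (m : R) :
  is_dist p -> (forall x, f x <= m) -> \sum_x p x * f x <= m.
Proof.
move=> [p_ge0 p1] f_le; rewrite -[leRHS]mul1r -p1 mulr_suml.
by apply: ler_sum => x _; exact: ler_wpM2l.
Qed.

Lemma dist_average_ge (R : realType) (T : finType) (p f : T -> R) (m : R) :
  is_dist p -> (forall x, m <= f x) -> m <= \sum_x p x * f x.
Proof.
move=> [p_ge0 p1] f_ge; rewrite -[leLHS]mul1r -p1 mulr_suml.
by apply: ler_sum => x _; exact: ler_wpM2l.
Qed.

(** * Discounted equations for a stochastic kernel *)

Section DiscountedKernel.
Variables (R : realType) (T : finType) (K : T -> T -> R) (g : R).
Hypotheses (hK : forall x, is_dist (K x)) (hg : 0 <= g < 1).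

(** Minimum principle: at a minimizer [x0] the average of [v] is at least [v x0], so
    [g * v x0 <= v x0], and [g < 1] forces [v x0 >= 0]. *)
Lemma discounted_supersolution_ge0 (v : T -> R) :
  (forall x, g * (\sum_y K x y * v y) <= v x) -> forall x, 0 <= v x.
Proof.
move=> hv x; have /andP[g0 g1] := hg.
case: (@Order.TotalTheory.arg_minP _ _ _ x xpredT v isT) => x0 _ min_x0.
apply: le_trans (min_x0 x isT).
have : g * v x0 <= v x0.
  apply: le_trans (hv x0); apply: ler_wpM2l => //.
  by apply: dist_average_ge => // y; exact: min_x0.
by move=> ?; nra.
Qed.

Lemma discounted_supersolution_ge (v h : T -> R) : (forall x, 0 <= h x) ->
  (forall x, h x + g * (\sum_y K x y * v y) <= v x) -> forall x, h x <= v x.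
Proof.
move=> h0 hv x; have /andP[g0 g1] := hg.
have v0 : forall y, 0 <= v y.
  apply: discounted_supersolution_ge0 => y.
  by apply: le_trans (hv y); rewrite lerDr.
apply: le_trans (hv x); rewrite lerDl mulr_ge0 //.
by apply: dist_average_ge.
Qed.

(** The constant [B / (1 - g)] solves [z = B + g * z]; the minimum principle applies to its
    difference with [v]. *)
Lemma discounted_subsolution_le (v : T -> R) (B : R) :
  (forall x, v x <= B + g * (\sum_y K x y * v y)) ->
  forall x, v x <= B / (1 - g).
Proof.
move=> hv x; have /andP[g0 g1] := hg.
have g1' : 1 - g != 0 by rewrite subr_eq0; lra.
rewrite -subr_ge0; move: x.
apply: (discounted_supersolution_ge0 (v := fun y => B / (1 - g) - v y)) => x.
under eq_bigr do rewrite mulrBr.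
rewrite sumrB -mulr_suml (hK x).2 mul1r.
have : B / (1 - g) = B + g * (B / (1 - g)) by field.
by move: (hv x); set a := B / _; set b := \sum_y _; lra.
Qed.

(** Value iteration; index [n] carries the terms of times 0 to [n], the same truncation as in
    [disc_exp]. *)
Fixpoint discounted_iter (f : T -> R) (n : nat) : T -> R :=
  if n is n'.+1 then
    fun x => f x + g * (\sum_y K x y * discounted_iter f n' y)
  else f.

Definition discounted_sum (f : T -> R) (x : T) : R :=
  lim ((fun n => discounted_iter f n x) @ \oo)%classic.

(** Nonnegativity of [f] makes the iterates nondecreasing, and [B / (1 - g)] bounds them, so the
    [lim] in [discounted_sum] is a true limit. *)
Lemma discounted_iter_cvg (f : T -> R) (B : R) (x : T) :
  (forall y, 0 <= f y <= B) ->
  ((fun n => discounted_iter f n x) @ \oo --> discounted_sum f x)%classic.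
Proof.
move=> hf; have /andP[g0 g1] := hg.
have f0 y : 0 <= f y by case/andP: (hf y).
have K0 y z : 0 <= K y z by exact: (hK y).1.
apply: nondecreasing_is_cvgn.
  apply/nondecreasing_seqP => n; elim: n x => [|n IHn] x /=.
    by rewrite lerDl mulr_ge0 //; apply: dist_average_ge.
  by rewrite lerD2l ler_wpM2l // ler_sum // => y _; rewrite ler_wpM2l // IHn.
have B0 : 0 <= B by case/andP: (hf x) => /le_trans /[apply].
exists (B / (1 - g)) => _ [n _ <-]; elim: n x => [|n IHn] x /=.
  have /andP[_ fB] := hf x; apply: (le_trans fB).
  by rewrite ler_pdivlMr; [nra|lra].
have -> : B / (1 - g) = B + g * (B / (1 - g)).
  by field; rewrite subr_eq0; lra.
have /andP[_ fB] := hf x.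
by apply: lerD => //; apply: ler_wpM2l => //; exact: dist_average_le.
Qed.

Lemma discounted_sumE (f : T -> R) (B : R) (x : T) :
  (forall y, 0 <= f y <= B) ->
  discounted_sum f x = f x + g * (\sum_y K x y * discounted_sum f y).
Proof.
move=> hf; rewrite {1}/discounted_sum; apply/cvg_lim => //.
rewrite -cvg_shiftS /=.
apply: cvgD; first exact: cvg_cst.
apply: cvgM; first exact: cvg_cst.
by apply: cvg_linear_combination => y; exact: discounted_iter_cvg hf.
Qed.

Lemma discounted_sum_bounds (f : T -> R) (B : R) (x : T) :
  (forall y, 0 <= f y <= B) -> f x <= discounted_sum f x <= B / (1 - g).
Proof.
move=> hf; have fW := fun y => discounted_sumE y hf.
apply/andP; split; move: x.
  by apply: discounted_supersolution_ge => [y|y]; [case/andP: (hf y)|rewrite -fW].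
apply: discounted_subsolution_le => x; rewrite {1}fW lerD2r.
by case/andP: (hf x).
Qed.

End DiscountedKernel.

(** * Splitting a finite path at its first entry *)

Definition ffun_cons (T : finType) (n : nat) (x : T) (h : {ffun 'I_n -> T}) :
    {ffun 'I_n.+1 -> T} :=
  [ffun i => oapp h x (unlift ord0 i)].

Lemma ffun_cons0 (T : finType) (n : nat) (x : T) (h : {ffun 'I_n -> T}) :
  ffun_cons x h ord0 = x.
Proof. by rewrite ffunE unlift_none. Qed.

Lemma ffun_consS (T : finType) (n : nat) (x : T) (h : {ffun 'I_n -> T})
    (i : 'I_n) :
  ffun_cons x h (lift ord0 i) = h i.
Proof. by rewrite ffunE liftK. Qed.

Lemma sum_ffun_recl (R : realType) (T : finType) (n : nat)
    (F : {ffun 'I_n.+1 -> T} -> R) :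
  \sum_h F h = \sum_x \sum_h F (ffun_cons x h).
Proof.
rewrite pair_big /= (reindex (fun p => ffun_cons p.1 p.2)) //=.
exists (fun h => (h ord0, [ffun i => h (lift ord0 i)])) => [[x h]|h] _ /=.
  rewrite ffun_cons0; congr pair.
  by apply/ffunP => i; rewrite ffunE ffun_consS.
apply/ffunP => i; have [j ->|->] := unliftP ord0 i.
  by rewrite ffun_consS ffunE.
by rewrite ffun_cons0.
Qed.

(** * The state-action chain of a policy: Bellman equations and bounds *)

Section Process.
Variables (R : realType) (S A : finType) (M : mdp R S A).
Variable (pi : S -> A -> R).
Hypothesis hpi : is_policy pi.
Local Notation g := (discount M).

Definition step_kernel (x y : S * A) : R := trans M x.1 x.2 y.1 * pi y.1 y.2.

Lemma step_kernel_sum (x : S * A) (f : S * A -> R) :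
  \sum_y step_kernel x y * f y =
  \sum_s trans M x.1 x.2 s * \sum_a pi s a * f (s, a).
Proof.
under [RHS]eq_bigr do rewrite mulr_sumr.
by rewrite pair_big /=; apply: eq_bigr => -[s a] _; rewrite mulrA.
Qed.

Lemma step_kernel_dist (x : S * A) : is_dist (step_kernel x).
Proof.
split=> [y|]; first by rewrite mulr_ge0 ?(transP M x.1 x.2).1 ?(hpi y.1).1.
have := step_kernel_sum x (fun=> 1).
under eq_bigr do rewrite mulr1.
move=> ->; under eq_bigr => s _.
  under eq_bigr do rewrite mulr1.
  rewrite (hpi s).2 mulr1; over.
exact: (transP M x.1 x.2).2.
Qed.

(** Markov property: after a first pair [x], the rest of the path is a path started from the law
    [step_kernel x]. Inductions on path length therefore quantify over the initial law. *)
Lemma path_law_cons (nu : S * A -> R) (n : nat) (x : S * A)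
    (h : {ffun 'I_n.+1 -> S * A}) :
  path_law M pi nu (ffun_cons x h) = nu x * path_law M pi (step_kernel x) h.
Proof.
rewrite /path_law big_ord_recl ffun_cons0; congr (_ * _); congr (_ * _).
  have -> : widen_ord (leqnSn n.+1) ord0 = ord0 by apply: val_inj.
  rewrite ffun_cons0 ffun_consS /step_kernel.
  by case: x => s a; case: (h ord0).
apply: eq_bigr => t _.
have -> : widen_ord (leqnSn n.+1) (lift ord0 t) =
    lift ord0 (widen_ord (leqnSn n) t) by apply: val_inj.
by rewrite !ffun_consS.
Qed.

Lemma path_law_mass (n : nat) (nu : S * A -> R) :
  is_dist nu -> \sum_(h : {ffun 'I_n.+1 -> S * A}) path_law M pi nu h = 1.
Proof.
elim: n nu => [|n IHn] nu hnu; rewrite sum_ffun_recl -[RHS]hnu.2.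
  apply: eq_bigr => x _.
  under eq_bigr do rewrite /path_law big_ord0 mulr1 ffun_cons0.
  by rewrite sumr_const card_ffun card_ord expn0 mulr1n.
apply: eq_bigr => x _; under eq_bigr do rewrite path_law_cons.
by rewrite -mulr_sumr IHn ?mulr1 //; exact: step_kernel_dist.
Qed.

(** First-step analysis: the time-0 payoff comes out because tail laws have mass 1, and one factor
    of the discount comes out of the shifted sum over the tail. *)
Lemma path_exp_discounted (f : S -> A -> R) (n : nat) (nu : S * A -> R) :
  path_exp M pi nu (fun h : {ffun 'I_n.+1 -> S * A} =>
    \sum_(t < n.+1) g ^+ t * f (h t).1 (h t).2) =
  \sum_x nu x * discounted_iter step_kernel g (fun x => f x.1 x.2) n x.
Proof.
elim: n nu => [|n IHn] nu; rewrite /path_exp sum_ffun_recl;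
  apply: eq_bigr => x _.
  under eq_bigr do rewrite /path_law big_ord0 mulr1 big_ord1 ffun_cons0 expr0 mul1r.
  by rewrite sumr_const card_ffun card_ord expn0 mulr1n.
under eq_bigr => h _.
  rewrite path_law_cons big_ord_recl ffun_cons0 expr0 mul1r.
  under eq_bigr do rewrite ffun_consS lift0 exprS -mulrA.
  rewrite -mulr_sumr -mulrA mulrDr; over.
rewrite -mulr_sumr big_split /= -mulr_suml path_law_mass; last exact: step_kernel_dist.
rewrite mul1r; congr (_ * (_ + _)).
under eq_bigr do rewrite mulrCA.
by rewrite -mulr_sumr -IHn.
Qed.

(** The payoff [f] is arbitrary so that rewards give [Q] and indicators of a state give
    [visitation]. *)
Definition qvalue (f : S -> A -> R) : S * A -> R :=
  discounted_sum step_kernel g (fun x => f x.1 x.2).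

Lemma disc_expE (nu : S * A -> R) (f : S -> A -> R) :
  (forall s a, 0 <= f s a <= 1) ->
  disc_exp M pi nu f = \sum_x nu x * qvalue f x.
Proof.
move=> hf; apply: cvg_lim => //.
under eq_fun do rewrite path_exp_discounted.
apply: cvg_linear_combination => x.
apply: (discounted_iter_cvg step_kernel_dist (discountP M) (B := 1)).
by move=> y; exact: hf.
Qed.

Lemma qvalueE (f : S -> A -> R) (s : S) (a : A) :
  (forall s a, 0 <= f s a <= 1) ->
  qvalue f (s, a) =
  f s a + g * \sum_s' trans M s a s' * \sum_a' pi s' a' * qvalue f (s', a').
Proof.
move=> hf; rewrite -(step_kernel_sum (s, a) (qvalue f)).
apply: (discounted_sumE step_kernel_dist (discountP M) (B := 1)).
by move=> y; exact: hf.
Qed.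

Lemma qvalue_bounds (f : S -> A -> R) (x : S * A) :
  (forall s a, 0 <= f s a <= 1) -> f x.1 x.2 <= qvalue f x <= 1 / (1 - g).
Proof.
move=> hf.
apply: (discounted_sum_bounds step_kernel_dist (discountP M)
  (f := fun x => f x.1 x.2) (B := 1)).
by move=> y; exact: hf.
Qed.

Lemma QE (s : S) (a : A) : Q M pi s a = qvalue (reward M) (s, a).
Proof.
rewrite /Q disc_expE; last exact: rewardP.
rewrite (bigD1 (s, a)) //= eqxx mul1r big1 ?addr0 // => y /negPf ->.
by rewrite mul0r.
Qed.

Lemma start_dist_sum (nu : S -> R) (f : S * A -> R) :
  \sum_x start_dist pi nu x * f x = \sum_s nu s * \sum_a pi s a * f (s, a).
Proof.
under [RHS]eq_bigr do rewrite mulr_sumr.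
by rewrite pair_big /=; apply: eq_bigr => -[s a] _; rewrite mulrA.
Qed.

Lemma VE (s : S) : V M pi s = \sum_a pi s a * Q M pi s a.
Proof.
rewrite /V disc_expE; last exact: rewardP.
rewrite start_dist_sum (bigD1 s) //= eqxx mul1r [X in _ + X]big1 ?addr0.
  by apply: eq_bigr => a _; rewrite QE.
by move=> y /negPf ->; rewrite mul0r.
Qed.

Lemma Q_bellman (s : S) (a : A) :
  Q M pi s a = reward M s a + g * \sum_s' trans M s a s' * V M pi s'.
Proof.
rewrite QE qvalueE; last exact: rewardP.
congr (_ + _ * _); apply: eq_bigr => s' _; rewrite VE; congr (_ * _).
by apply: eq_bigr => a' _; rewrite QE.
Qed.

Lemma Q_bounds (s : S) (a : A) : 0 <= Q M pi s a <= 1 / (1 - g).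
Proof.
have := qvalue_bounds (s, a) (rewardP M); rewrite QE => /andP[rQ ->].
by rewrite (le_trans _ rQ) //; case/andP: (rewardP M s a).
Qed.

Lemma V_bounds (s : S) : 0 <= V M pi s <= 1 / (1 - g).
Proof.
rewrite VE; apply/andP; split.
  by apply: dist_average_ge => // a; case/andP: (Q_bounds s a).
by apply: dist_average_le => // a; case/andP: (Q_bounds s a).
Qed.

(** The lower bound keeps only the time-0 visit; the upper one uses that an indicator payoff has
    discounted total at most [1 / (1 - g)]. *)
Lemma visitation_bounds (nu : S -> R) (s : S) : is_dist nu ->
  (1 - g) * nu s <= visitation M pi nu s <= 1.
Proof.
move=> [nu0 nu1]; have /andP[g0 g1] := discountP M.
have g1' : 0 < 1 - g by lra.
have hf (s' : S) (a : A) : 0 <= ((s' == s)%:R : R) <= 1 by case: eqP => _ /=; rewrite ?lexx ?ler01.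
have bnd := fun x => qvalue_bounds x hf.
rewrite /visitation disc_expE //; apply/andP; split.
  rewrite ler_pM2l // start_dist_sum (bigD1 s) //=.
  rewrite -[leLHS]addr0 lerD //.
    rewrite ler_peMr //; apply: dist_average_ge => // a.
    by case/andP: (bnd (s, a)); rewrite /= eqxx.
  apply: sumr_ge0 => s' _; apply: mulr_ge0 => //.
  apply: dist_average_ge => // a; case/andP: (bnd (s', a)) => + _.
  by apply: le_trans; case/andP: (hf s' a).
rewrite mulrC -ler_pdivlMr // start_dist_sum.
apply: dist_average_le => // s'; apply: dist_average_le => // a.
by case/andP: (bnd (s', a)).
Qed.

End Process.

(** * Comparison of policies and optimal values *)

Section Optimality.
Variables (R : realType) (S A : finType) (M : mdp R S A).
Local Notation g := (discount M).

Definition state_kernel (pi : S -> A -> R) (s s' : S) : R :=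
  \sum_a pi s a * trans M s a s'.

Lemma state_kernel_sum (pi : S -> A -> R) (s : S) (f : S -> R) :
  \sum_s' state_kernel pi s s' * f s' =
  \sum_a pi s a * \sum_s' trans M s a s' * f s'.
Proof.
under eq_bigr do rewrite mulr_suml.
rewrite exchange_big /=; apply: eq_bigr => a _; rewrite mulr_sumr.
by apply: eq_bigr => s' _; rewrite mulrA.
Qed.

Lemma state_kernel_dist (pi : S -> A -> R) (s : S) :
  is_policy pi -> is_dist (state_kernel pi s).
Proof.
move=> hpi; split=> [s'|].
  by apply: sumr_ge0 => a _; rewrite mulr_ge0 ?(hpi s).1 ?(transP M s a).1.
have := state_kernel_sum pi s (fun=> 1).
under eq_bigr do rewrite mulr1.
move=> ->; rewrite -[RHS](hpi s).2; apply: eq_bigr => a _.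
by under eq_bigr do rewrite mulr1; rewrite (transP M s a).2 mulr1.
Qed.

Lemma Adv_mean0 (pi : S -> A -> R) (s : S) :
  is_policy pi -> \sum_a pi s a * Adv M pi s a = 0.
Proof.
move=> hpi; under eq_bigr do rewrite mulrBr.
by rewrite sumrB -mulr_suml (hpi s).2 mul1r -VE // subrr.
Qed.

Lemma Adv_norm_le (pi : S -> A -> R) (s : S) (a : A) :
  is_policy pi -> `|Adv M pi s a| <= 1 / (1 - g).
Proof.
move=> hpi; have := Q_bounds M hpi s a; have := V_bounds M hpi s.
by rewrite /Adv ler_norml => /andP[? ?] /andP[? ?]; apply/andP; split; lra.
Qed.

(** Performance difference lemma in one-step form: a discounted equation along [pi'], ready for the
    comparison principles above. *)
Lemma value_difference (pi pi' : S -> A -> R) (s : S) :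
  is_policy pi -> is_policy pi' ->
  V M pi' s - V M pi s = \sum_a pi' s a * Adv M pi s a +
    g * \sum_s' state_kernel pi' s s' * (V M pi' s' - V M pi s').
Proof.
move=> hpi hpi'; rewrite state_kernel_sum mulr_sumr -big_split /=.
rewrite [V M pi' s]VE // -[V M pi s in LHS]mul1r -(hpi' s).2 mulr_suml -sumrB.
apply: eq_bigr => a _; rewrite mulrCA -mulrDr -mulrBr; congr (_ * _).
rewrite /Adv !Q_bellman //; under [in RHS]eq_bigr do rewrite mulrBr.
by rewrite sumrB; ring.
Qed.

Lemma V_le_Vstar (pi : S -> A -> R) (s : S) :
  is_policy pi -> V M pi s <= Vstar M s.
Proof.
move=> hpi; apply: ub_le_sup; last by exists pi.
by exists (1 / (1 - g)) => _ [p hp <-]; case/andP: (V_bounds M hp s).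
Qed.

(** By the Bellman equation [Q] is monotone in the state values, which [pistar] maximizes at every
    state, so [pistar] attains the supremum defining [Qstar]. *)
Lemma Qstar_optimal (pistar : S -> A -> R) (s : S) (a : A) :
  is_optimal M pistar -> Qstar M s a = Q M pistar s a.
Proof.
move=> [hpol hopt].
have Q_le pi : is_policy pi -> Q M pi s a <= Q M pistar s a.
  move=> hpi; have /andP[g0 _] := discountP M.
  rewrite !Q_bellman // lerD2l; apply: ler_wpM2l => //.
  apply: ler_sum => s' _; apply: ler_wpM2l; first exact: (transP M s a).1.
  by rewrite hopt; exact: V_le_Vstar.
apply/eqP; rewrite eq_le; apply/andP; split.
  apply: ge_sup; first by exists (Q M pistar s a), pistar.
  by move=> _ [pi hpi <-]; exact: Q_le.
apply: ub_le_sup; last by exists pistar.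
by exists (Q M pistar s a) => _ [pi hpi <-]; exact: Q_le.
Qed.

(* Otherwise playing [a] at [s] and following [pistar] elsewhere would improve
   on [pistar]. *)
Lemma Adv_optimal_le0 (pistar : S -> A -> R) (s : S) (a : A) :
  is_optimal M pistar -> Adv M pistar s a <= 0.
Proof.
move=> [hpol hopt]; rewrite leNgt; apply/negP => adv_gt0.
pose pi s' := if s' == s then fun b => (b == a)%:R : R else pistar s'.
have hpi : is_policy pi.
  move=> s'; rewrite /pi; case: eqP => [_|_]; last exact: hpol.
  split=> [b|]; first exact: ler0n.
  by rewrite (bigD1 a) //= eqxx big1 ?addr0 // => b /negPf ->.
have advE s' : \sum_b pi s' b * Adv M pistar s' b =
    if s' == s then Adv M pistar s a else 0.
  rewrite /pi; case: eqP => [->|_]; last exact: Adv_mean0.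
  rewrite (bigD1 a) //= eqxx mul1r big1 ?addr0 // => b /negPf ->.
  by rewrite mul0r.
have := discounted_supersolution_ge
  (fun x => state_kernel_dist x hpi) (discountP M)
  (v := fun x => V M pi x - V M pistar x)
  (h := fun x => if x == s then Adv M pistar s a else 0) _ _ s.
rewrite eqxx => H; have : Adv M pistar s a <= V M pi s - V M pistar s.
  apply: H => x; first by case: ifP => // _; exact: ltW.
  by rewrite [leRHS]value_difference // advE.
by have := V_le_Vstar s hpi; rewrite hopt; lra.
Qed.

Lemma Q_le_Vstar (pistar pi : S -> A -> R) (s : S) (a : A) :
  is_optimal M pistar -> is_policy pi -> Q M pi s a <= Vstar M s.
Proof.
move=> hopt hpi; have := Adv_optimal_le0 s a hopt.
rewrite /Adv hopt.2 subr_le0; apply: le_trans.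
have /andP[g0 _] := discountP M; rewrite !Q_bellman //; last exact: hopt.1.
rewrite lerD2l ler_wpM2l // ler_sum // => s' _.
rewrite ler_wpM2l ?(transP M s a).1 //.
by rewrite hopt.2; exact: V_le_Vstar.
Qed.

(** The one-step regret at [s]. It is linear in [pi], so entrywise bounds between policies transfer
    to it; the suboptimality is its discounted sum along [pi]. *)
Definition policy_gap (pistar pi : S -> A -> R) (s : S) : R :=
  \sum_a pi s a * - Adv M pistar s a.

Lemma policy_gap_ge0 (pistar pi : S -> A -> R) (s : S) :
  is_optimal M pistar -> is_policy pi -> 0 <= policy_gap pistar pi s.
Proof.
move=> hopt hpi; apply: dist_average_ge => // a.
by rewrite oppr_ge0; exact: Adv_optimal_le0.
Qed.

Lemma suboptimality_bellman (pistar pi : S -> A -> R) (s : S) :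
  is_optimal M pistar -> is_policy pi ->
  Vstar M s - V M pi s = policy_gap pistar pi s +
    g * \sum_s' state_kernel pi s s' * (Vstar M s' - V M pi s').
Proof.
move=> [hpol hopt] hpi; rewrite -[LHS]opprB -hopt value_difference //.
rewrite opprD -mulrN -!sumrN /policy_gap; congr (_ + _ * _).
  by apply: eq_bigr => a _; rewrite mulrN.
by apply: eq_bigr => s' _; rewrite -mulrN opprB hopt.
Qed.

Lemma policy_gap_le (pistar pi : S -> A -> R) (s : S) :
  is_optimal M pistar -> is_policy pi ->
  policy_gap pistar pi s <= Vstar M s - V M pi s.
Proof.
move=> hopt hpi; move: s; apply: (discounted_supersolution_ge
  (fun x => state_kernel_dist x hpi) (discountP M)) => s.
  exact: policy_gap_ge0.
by rewrite -suboptimality_bellman.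
Qed.

Lemma suboptimality_le (pistar pi : S -> A -> R) (s : S) :
  is_optimal M pistar -> is_policy pi ->
  Vstar M s - V M pi s <= (\sum_s' policy_gap pistar pi s') / (1 - g).
Proof.
move=> hopt hpi; move: s; apply: (discounted_subsolution_le
  (fun x => state_kernel_dist x hpi) (discountP M)
  (v := fun x => Vstar M x - V M pi x)) => s.
rewrite [leLHS](suboptimality_bellman s hopt) // lerD2r (bigD1 s) //= lerDl.
by apply: sumr_ge0 => s' _; exact: policy_gap_ge0.
Qed.

(** * Suboptimality averaged over the initial distribution *)

Section Averaged.
Variables (rho : S -> R) (pistar : S -> A -> R).
Hypotheses (hrho : is_dist rho) (hopt : is_optimal M pistar).

Lemma min_entry_le (s : S) : min_entry rho <= rho s.
Proof. exact: bigmin_le. Qed.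

Lemma avg_suboptimality (pi : S -> A -> R) :
  avg rho (Vstar M) - avg rho (V M pi) =
  \sum_s rho s * (Vstar M s - V M pi s).
Proof. by rewrite /avg -sumrB; apply: eq_bigr => s _; rewrite mulrBr. Qed.

Lemma suboptimality_le_avg (pi : S -> A -> R) (s : S) :
  is_policy pi -> 0 < min_entry rho ->
  Vstar M s - V M pi s <=
  (avg rho (Vstar M) - avg rho (V M pi)) / min_entry rho.
Proof.
move=> hpi rho_gt0; rewrite ler_pdivlMr // mulrC avg_suboptimality.
have e_ge0 s' : 0 <= Vstar M s' - V M pi s'.
  by rewrite subr_ge0; exact: V_le_Vstar.
rewrite (bigD1 s) //= -[leLHS]addr0 lerD //.
  by rewrite ler_wpM2r // min_entry_le.
by apply: sumr_ge0 => s' _; rewrite mulr_ge0 ?hrho.1.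
Qed.

(** Both sides pass through the total one-step regret: for [pi] it bounds the suboptimality up to
    [1 / (1 - g)], for [pi'] each state's regret is a lower bound, and the regret of [pi'] is at
    least [c] times that of [pi]. *)
Lemma avg_suboptimality_ge (pi pi' : S -> A -> R) (c : R) :
  is_policy pi -> is_policy pi' -> 0 <= c -> 0 <= min_entry rho ->
  (forall s a, c * pi s a <= pi' s a) ->
  min_entry rho * c * (1 - g) * (avg rho (Vstar M) - avg rho (V M pi)) <=
  avg rho (Vstar M) - avg rho (V M pi').
Proof.
move=> hpi hpi' c0 rho0 hc; have /andP[_ g1] := discountP M.
set G := \sum_s policy_gap pistar pi s.
have : avg rho (Vstar M) - avg rho (V M pi) <= G / (1 - g).
  rewrite avg_suboptimality; apply: dist_average_le => // s.
  exact: suboptimality_le.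
rewrite ler_pdivlMr ?subr_gt0 // [_ * (1 - g)]mulrC => /(ler_wpM2l (mulr_ge0 rho0 c0)).
rewrite mulrA => /le_trans; apply; rewrite avg_suboptimality mulr_sumr.
apply: ler_sum => s _; rewrite -mulrA; apply: ler_pM => //.
- by rewrite mulr_ge0 //; exact: policy_gap_ge0.
- exact: min_entry_le.
apply: le_trans (policy_gap_le s hopt hpi').
rewrite /policy_gap mulr_sumr; apply: ler_sum => a _; rewrite mulrA.
by rewrite ler_wpM2r // oppr_ge0; exact: Adv_optimal_le0.
Qed.

(** At a nontrivial state some action has negative advantage under [pistar]; a positive policy plays
    it, so its regret there is positive. *)
Lemma avg_suboptimality_gt0 (pi : S -> A -> R) :
  is_policy pi -> (forall s a, 0 < pi s a) -> 0 < min_entry rho ->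
  nontrivial_states M != finset.set0 ->
  0 < avg rho (Vstar M) - avg rho (V M pi).
Proof.
move=> hpi pi_gt0 rho_gt0 /set0Pn[s]; rewrite inE => hs.
have [a ha] : exists a, Adv M pistar s a < 0.
  move: hs; rewrite finset.eqEsubset finset.subsetT /= => /subsetPn[a _].
  rewrite inE negb_forall => /existsP[b]; rewrite -ltNge /Astar.
  rewrite ltrD2r !(Qstar_optimal _ _ hopt) => hab; exists a.
  by have := Adv_optimal_le0 s b hopt; rewrite /Adv; lra.
have gap_gt0 : 0 < policy_gap pistar pi s.
  rewrite /policy_gap (bigD1 a) //=; apply: ltr_pwDl.
    by rewrite mulr_gt0 ?oppr_gt0.
  apply: sumr_ge0 => b _; rewrite mulr_ge0 ?(ltW (pi_gt0 s b)) // oppr_ge0.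
  exact: Adv_optimal_le0.
have := suboptimality_le_avg s hpi rho_gt0; rewrite ler_pdivlMr //.
apply: lt_le_trans; rewrite mulr_gt0 //.
exact: lt_le_trans (policy_gap_le s hopt hpi).
Qed.

End Averaged.

End Optimality.

(** * Two elementary inequalities *)

(* Chord bound for the convex function [expR]: combine the tangent-line bounds
   at [l * x] for the values at [0] and at [x]. *)
Lemma expR_chord (R : realType) (l x : R) :
  0 <= l <= 1 -> expR (l * x) <= 1 + l * (expR x - 1).
Proof.
move=> /andP[l0 l1].
have e0 : expR (l * x) * (1 - l * x) <= 1.
  have := expR_ge1Dx (- (l * x)); rewrite expRN.
  by rewrite -[X in _ <= X]mul1r ler_pdivlMr ?expR_gt0 // mulrC.
have e1 : expR (l * x) * (1 + (x - l * x)) <= expR x.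
  have := expR_ge1Dx (x - l * x); rewrite expRB.
  by rewrite ler_pdivlMr ?expR_gt0 // mulrC.
have := ler_wpM2l l0 e1.
have l1' : 0 <= 1 - l by lra.
have := ler_wpM2l l1' e0.
by move: (expR _) (expR x) => a b; lra.
Qed.

(** The positive parts [v] add up to at most [m], and so do the negative parts [v - u] because [u]
    sums to 0. Each part is then at most [m], so [u ^+ 2] is at most [m] times the sum of the
    two. *)
Lemma sum_sqr_le_of_sum0 (R : realType) (A : finType) (p u : A -> R) (m : R) :
  is_dist p -> \sum_a u a = 0 -> 0 <= m -> (forall a, u a <= p a * m) ->
  \sum_a u a ^+ 2 <= 2 * m ^+ 2.
Proof.
move=> hp u0 m0 hu; pose v a := Num.max (u a) 0.
have v_ge a : 0 <= v a /\ u a <= v a.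
  by rewrite /v !le_max !lexx orbT.
have v_le a : v a <= p a * m.
  by rewrite /v ge_max hu mulr_ge0 ?hp.1.
have sum_v : \sum_a v a <= m.
  apply: le_trans (ler_sum _ (fun a _ => v_le a)) _.
  by rewrite -mulr_suml hp.2 mul1r.
have entry_le (w : A -> R) a : (forall b, 0 <= w b) -> w a <= \sum_b w b.
  by move=> w0; rewrite (bigD1 a) //= lerDl sumr_ge0.
have sum_w : \sum_a (v a - u a) <= m by rewrite sumrB u0 subr0.
have -> : 2 * m ^+ 2 = m * (m + m) by ring.
apply: le_trans (_ : \sum_a m * (v a + (v a - u a)) <= _); last first.
  by rewrite -mulr_sumr big_split /= ler_wpM2l // lerD.
apply: ler_sum => a _; have [v0 uv] := v_ge a.
have hv : v a <= m by apply: le_trans sum_v; apply: entry_le => b; case: (v_ge b).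
have hw : v a - u a <= m.
  apply: le_trans sum_w; apply: (entry_le (fun a => v a - u a)) => b.
  by rewrite subr_ge0; case: (v_ge b).
have -> : u a ^+ 2 = (v a - (v a - u a)) ^+ 2 by ring.
have w0 : 0 <= v a - u a by rewrite subr_ge0.
by move: (v a) (v a - u a) v0 w0 hv hw => x y *; nra.
Qed.

(** * One exponential update of a distribution *)

Definition exp_weight (R : realType) (A : finType) (p adv : A -> R) (t : R)
    (a : A) : R := p a * expR (t * p a * adv a).

Section ExponentialUpdate.
Variables (R : realType) (A : finType) (p adv : A -> R) (t tau B : R).
Hypotheses (hp : is_dist p) (ht : 0 <= t <= tau) (hB : 0 < B)
  (hadv : forall a, `|adv a| <= B).
Local Notation w := (exp_weight p adv t).
Local Notation L := (tau * B).

Lemma update_exponent_norm_le (a : A) : `|t * p a * adv a| <= L.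
Proof.
have /andP[t0 t1] := ht; have p0 := hp.1 a; have p1 := dist_entry_le1 a hp.
rewrite !normrM (ger0_norm t0) (ger0_norm p0).
apply: ler_pM => //; first by rewrite mulr_ge0.
by rewrite -[tau]mulr1; exact: ler_pM.
Qed.

Lemma update_normalizer_bounds : expR (- L) <= \sum_a w a <= expR L.
Proof.
rewrite /exp_weight; apply/andP; split.
  apply: dist_average_ge => // a; rewrite ler_expR.
  by have := update_exponent_norm_le a; rewrite ler_norml => /andP[].
apply: dist_average_le => // a; rewrite ler_expR.
by have := update_exponent_norm_le a; rewrite ler_norml => /andP[].
Qed.

Lemma update_normalizer_gt0 : 0 < \sum_a w a.
Proof.
by have /andP[+ _] := update_normalizer_bounds; apply: lt_le_trans; exact: expR_gt0.
Qed.

Lemma update_is_dist : is_dist (fun a => w a / \sum_b w b).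
Proof.
have Z0 := update_normalizer_gt0; split=> [a|].
  by rewrite divr_ge0 ?(ltW Z0) // mulr_ge0 ?expR_ge0 ?hp.1.
by rewrite -mulr_suml divff // gt_eqF.
Qed.

(** One factor [expR (- L)] comes from the weight and one from the normalizer. *)
Lemma update_ge (a : A) : expR (- (2 * L)) * p a <= w a / \sum_b w b.
Proof.
have Z0 := update_normalizer_gt0.
have /andP[_ ZL] := update_normalizer_bounds.
have := update_exponent_norm_le a; rewrite ler_norml => /andP[hL _].
rewrite ler_pdivlMr // [expR _ * _]mulrC -mulrA.
apply: ler_wpM2l; first exact: hp.1.
apply: le_trans (ler_wpM2l (expR_ge0 _) ZL) _.
by rewrite -expRD ler_expR; lra.
Qed.

(** With [u = p a * adv a], the chord bound at the fraction [u / B] handles [u >= 0]. For [u < 0]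
    multiplication reverses the tangent bound [1 + t * u], and [t <= (expR L - 1) / B]. *)
Lemma update_gain_term_le (a : A) :
  p a * adv a * expR (t * p a * adv a) <=
  p a * adv a + (p a * adv a) ^+ 2 * ((expR L - 1) / B).
Proof.
have /andP[t0 t1] := ht; have p0 := hp.1 a; have p1 := dist_entry_le1 a hp.
rewrite -[t * p a * _]mulrA; set u := p a * adv a.
have uB : `|u| <= B.
  rewrite normrM (ger0_norm p0) -[B]mul1r; exact: ler_pM.
have L0 : 0 <= L by rewrite mulr_ge0 ?(ltW hB) //; lra.
have eL : L <= expR L - 1 by have := expR_ge1Dx L; lra.
have [u0|u0] := leP 0 u.
  have uB1 : 0 <= u / B <= 1.
    rewrite divr_ge0 ?(ltW hB) //= ler_pdivrMr // mul1r.
    by rewrite ger0_norm in uB.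
  have : expR (t * u) <= 1 + u / B * (expR L - 1).
    apply: le_trans (expR_chord L uB1); rewrite ler_expR.
    have -> : u / B * L = tau * u by field; rewrite gt_eqF.
    by rewrite ler_wpM2r.
  move=> /(ler_wpM2l u0) /le_trans; apply.
  by rewrite le_eqVlt; apply/orP; left; apply/eqP; ring.
have h1 := expR_ge1Dx (t * u).
have h2 : t <= (expR L - 1) / B.
  by rewrite ler_pdivlMr //; apply: le_trans eL; rewrite ler_wpM2r // ltW.
move: (expR (t * u)) ((expR L - 1) / B) h1 h2 => x y h1 h2.
have : u ^+ 2 * t <= u ^+ 2 * y by rewrite ler_wpM2l // sqr_ge0.
have : u * x <= u * (1 + t * u) by rewrite ler_wnM2l // ltW.
by lra.
Qed.

Lemma update_gain_le (m : R) : \sum_a p a * adv a = 0 -> 0 <= m ->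
  (forall a, adv a <= m) ->
  \sum_a w a / (\sum_b w b) * adv a <= (expR (2 * L) - 1) / B * (2 * m ^+ 2).
Proof.
move=> adv0 m0 adv_le; have Z0 := update_normalizer_gt0.
have /andP[t0 t1] := ht.
have L0 : 0 <= L by rewrite mulr_ge0 ?(ltW hB) //; lra.
have e1 : 1 <= expR L by rewrite -expR0 ler_expR.
have Zge : expR L * \sum_b w b >= 1.
  have /andP[+ _] := update_normalizer_bounds.
  by rewrite expRN -[X in X <= _ -> _]mul1r ler_pdivrMr ?expR_gt0 // mulrC.
under eq_bigr do rewrite mulrAC.
rewrite -mulr_suml ler_pdivrMr //.
(* Unnormalized gain first: its linear part vanishes by [adv0], which leaves the sum of squares. *)
apply: le_trans (_ : (expR L - 1) / B * (2 * m ^+ 2) <= _).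
  apply: le_trans (_ : \sum_a (p a * adv a +
      (p a * adv a) ^+ 2 * ((expR L - 1) / B)) <= _).
    by apply: ler_sum => a _; rewrite /exp_weight mulrAC; exact: update_gain_term_le.
  rewrite big_split /= adv0 add0r -mulr_suml mulrC.
  apply: ler_wpM2l; first by rewrite divr_ge0 ?(ltW hB) // subr_ge0.
  apply: (sum_sqr_le_of_sum0 hp) => // a.
  by apply: ler_wpM2l; [exact: hp.1|exact: adv_le].
have y0 : 0 <= B^-1 * (2 * m ^+ 2).
  by rewrite mulr_ge0 ?invr_ge0 ?(ltW hB) // mulr_ge0 // sqr_ge0.
rewrite -![_ / B * _]mulrA [leRHS]mulrAC; apply: ler_wpM2r => //.
rewrite [2 * L]mulrDl mul1r expRD.
(* With [x = expR L], [(x^2 - 1) Z = (x - 1)(x Z + Z) >= x - 1] because [x Z >= 1]; this absorbs the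
   normalizer. *)
by move: (\sum_b w b) (expR L) Z0 Zge e1 => Z x Z0 Zge e1; nra.
Qed.

End ExponentialUpdate.

(** * Rate of a positive sequence with quadratically bounded decrease *)

Lemma quadratic_decrease_rate (R : realType) (d : nat -> R) (c C sigma : R) :
  (forall k, 0 < d k) -> 0 < c -> 0 < C -> 0 < sigma < 1 ->
  (forall k, c * d k <= d k.+1) ->
  (forall k, d k - C * d k ^+ 2 <= d k.+1) ->
  exists T : nat, forall k : nat, (T <= k)%N ->
    k%:R^-1 * ((1 - sigma) / C) <= d k.
Proof.
move=> d0 c0 C0 /andP[s0 s1] hc hC.
(* Any [e] strictly between 0 and [sigma] leaves slack to absorb [K0]. The two entries of [K0] cover
   the initial term and each step from a large [d k]. *)
pose e := sigma / 2; pose K0 := Num.max (d 0%N)^-1 (C / (e * c)).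
have e0 : 0 < e by rewrite /e; lra.
have e1 : e < 1 by rewrite /e; lra.
have inv_le k : (d k)^-1 <= K0 + k%:R * (C / (1 - e)).
  elim: k => [|k IHk]; first by rewrite mul0r addr0 le_max lexx.
  (* If [C * d k > e], then [d k.+1 >= c * d k > c * e / C], and the bound restarts from [K0].
     Otherwise the inverse grows by at most [C / (1 - e)]. *)
  have [small|large] := leP (C * d k) e; last first.
    apply: (@le_trans _ _ K0); last first.
      by rewrite lerDl mulr_ge0 // divr_ge0 //; lra.
    rewrite le_max; apply/orP; right.
    rewrite -[leRHS]invrK lef_pV2 ?posrE ?invr_gt0 ?divr_gt0 ?mulr_gt0 //.
    rewrite invf_div; apply: le_trans (hc k).
    by rewrite ler_pdivrMr //; nra.
  have f0 : 0 < 1 - C * d k by lra.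
  have step : (d k.+1)^-1 <= (d k)^-1 + C / (1 - C * d k).
    have -> : (d k)^-1 + C / (1 - C * d k) = (d k * (1 - C * d k))^-1.
      by field; rewrite !gt_eqF.
    rewrite lef_pV2 ?posrE ?mulr_gt0 //; apply: le_trans (hC k).
    by rewrite le_eqVlt; apply/orP; left; apply/eqP; ring.
  apply: (le_trans step); rewrite -natr1 mulrDl mul1r addrA lerD //.
  by rewrite ler_wpM2l ?(ltW C0) // lef_pV2 ?posrE //; lra.
pose b := C / (1 - sigma) - C / (1 - e).
have b0 : 0 < b.
  have es : e < sigma by rewrite /e; lra.
  by rewrite subr_gt0 ltr_pM2l // ltf_pV2 ?posrE; lra.
have K00 : 0 < K0 by rewrite lt_max invr_gt0 d0.
(* From this time on [k * b >= K0], so replacing [e] by [sigma] in the slope pays for [K0]. Since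
   [K0 > 0], this also forces [k > 0]. *)
exists (Num.bound (K0 / b)) => k hk.
have kb : K0 <= k%:R * b.
  rewrite -ler_pdivrMr //; apply: le_trans (_ : (Num.bound (K0 / b))%:R <= _).
    by apply/ltW/archi_boundP; rewrite divr_ge0 // ltW.
  by rewrite ler_nat.
have k0 : (0 : R) < k%:R by rewrite -(pmulr_lgt0 _ b0); apply: lt_le_trans kb.
have -> : k%:R^-1 * ((1 - sigma) / C) = (k%:R * (C / (1 - sigma)))^-1.
  by field; rewrite !gt_eqF //; lra.
rewrite -[leRHS]invrK lef_pV2 ?posrE ?invr_gt0 ?mulr_gt0 ?invr_gt0 ?subr_gt0 //.
by apply: (le_trans (inv_le k)); move: kb; rewrite /b mulrBr; lra.
Qed.

(** * The policy gradient step as an exponential update *)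

Section PolicyGradient.
Variables (R : realType) (S A : finType) (M : mdp R S A).
Variables (mu : S -> R) (eta : R).
Hypotheses (hmu : is_dist mu) (heta : 0 < eta).
Local Notation g := (discount M).
Local Notation L := (eta / (1 - g) ^+ 2).

Lemma softmax_is_positive_policy (pi : S -> A -> R) :
  is_softmax pi -> (0 < #|A|)%N -> is_policy pi /\ forall s a, 0 < pi s a.
Proof.
move=> [theta thetaE] /card_gt0P[a0 _].
have Z0 s : 0 < \sum_b expR (theta s b).
  rewrite (bigD1 a0) //=; apply: ltr_pwDl; first exact: expR_gt0.
  by apply: sumr_ge0 => b _; exact: expR_ge0.
have pi0 s a : 0 < pi s a by rewrite thetaE divr_gt0 // expR_gt0.
split=> // s; split=> [a|]; first exact: ltW.
under eq_bigr do rewrite thetaE.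
by rewrite -mulr_suml divff // gt_eqF.
Qed.

Lemma pg_step_size_bounds (pi : S -> A -> R) (s : S) : is_policy pi ->
  0 <= eta / (1 - g) * visitation M pi mu s <= eta / (1 - g).
Proof.
move=> hpi; have /andP[g0 g1] := discountP M.
have /andP[v0 v1] := visitation_bounds M hpi s hmu.
have t0 : 0 < eta / (1 - g) by rewrite divr_gt0 // subr_gt0.
have {}v0 : 0 <= visitation M pi mu s.
  by apply: le_trans v0; rewrite mulr_ge0 ?hmu.1 //; lra.
by rewrite mulr_ge0 ?(ltW t0) //= ler_piMr // ltW.
Qed.

(** Identifies the exponent bound [tau * B] of the update lemmas, with [tau = eta / (1 - g)] and
    [B = 1 / (1 - g)]. *)
Lemma step_size_horizon : eta / (1 - g) * (1 / (1 - g)) = L.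
Proof.
have /andP[g0 g1] := discountP M.
by field; rewrite subr_eq0 gt_eqF.
Qed.

Lemma horizon_gt0 : 0 < 1 / (1 - g).
Proof. by rewrite divr_gt0 // subr_gt0; case/andP: (discountP M). Qed.

Lemma pg_step_is_policy (pi : S -> A -> R) :
  is_policy pi -> is_policy (pg_step M eta mu pi).
Proof.
move=> hpi s; apply: (update_is_dist (adv := Adv M pi s) (hpi s)
  (pg_step_size_bounds s hpi)) => a.
exact: Adv_norm_le.
Qed.

Lemma pg_step_ge (pi : S -> A -> R) (s : S) (a : A) : is_policy pi ->
  expR (- (2 * L)) * pi s a <= pg_step M eta mu pi s a.
Proof.
move=> hpi; rewrite -step_size_horizon.
apply: (update_ge (adv := Adv M pi s) (hpi s) (pg_step_size_bounds s hpi)) => b.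
exact: Adv_norm_le.
Qed.

Lemma pg_step_progress_le (pistar pi : S -> A -> R) (rho : S -> R) :
  is_dist rho -> 0 < min_entry rho ->
  is_optimal M pistar -> is_policy pi ->
  avg rho (V M (pg_step M eta mu pi)) - avg rho (V M pi) <=
  2 * (expR (2 * L) - 1) / min_entry rho ^+ 2 *
    (avg rho (Vstar M) - avg rho (V M pi)) ^+ 2.
Proof.
move=> hrho rho_gt0 hopt hpi; have /andP[g0 g1] := discountP M.
set d := avg rho (Vstar M) - _; set pi' := pg_step M eta mu pi.
have hpi' : is_policy pi' by exact: pg_step_is_policy.
have V_gap s : Vstar M s - V M pi s <= d / min_entry rho.
  exact: suboptimality_le_avg.
have d0 : 0 <= d.
  rewrite /d avg_suboptimality; apply: sumr_ge0 => s _.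
  by rewrite mulr_ge0 ?hrho.1 // subr_ge0; exact: V_le_Vstar.
have gain s : \sum_a pi' s a * Adv M pi s a <=
    (expR (2 * L) - 1) / (1 / (1 - g)) * (2 * (d / min_entry rho) ^+ 2).
  rewrite -step_size_horizon.
  apply: (update_gain_le (adv := Adv M pi s) (hpi s)
    (pg_step_size_bounds s hpi) horizon_gt0).
  - by move=> a; exact: Adv_norm_le.
  - exact: Adv_mean0.
  - by rewrite divr_ge0 // ltW.
  - move=> a; apply: le_trans (V_gap s); rewrite /Adv lerD2r.
    exact: Q_le_Vstar hopt hpi.
have diff s : V M pi' s - V M pi s <=
    (expR (2 * L) - 1) / (1 / (1 - g)) * (2 * (d / min_entry rho) ^+ 2) / (1 - g).
  move: s; apply: (discounted_subsolution_le
    (fun x => state_kernel_dist M x hpi') (discountP M)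
    (v := fun x => V M pi' x - V M pi x)) => s.
  by rewrite [leLHS]value_difference // lerD2r.
rewrite /avg -sumrB; under eq_bigr do rewrite -mulrBr.
apply: le_trans (dist_average_le hrho diff) _.
rewrite le_eqVlt; apply/orP; left; apply/eqP.
by field; rewrite gt_eqF //= subr_eq0 gt_eqF.
Qed.

(** Positivity survives each step because an update shrinks probabilities by a bounded factor. *)
Lemma softmax_pg_is_positive_policy (pi : nat -> S -> A -> R) (k : nat) :
  softmax_pg M (fun=> eta) mu pi -> (0 < #|A|)%N ->
  is_policy (pi k) /\ forall s a, 0 < pi k s a.
Proof.
move=> [pi0 piS] A0; elim: k => [|k [hpol hpos]].
  exact: softmax_is_positive_policy.
have pi_ge s a : expR (- (2 * L)) * pi k s a <= pi k.+1 s a.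
  by rewrite piS; exact: pg_step_ge.
split=> [s|s a]; last by apply: lt_le_trans (pi_ge s a); rewrite mulr_gt0 ?expR_gt0.
by have -> : pi k.+1 s = pg_step M eta mu (pi k) s;
  [apply/funext => a; rewrite piS | exact: pg_step_is_policy].
Qed.

End PolicyGradient.

(** * Constants and conclusion *)

Lemma inv_norm_infty_visitation_bounds (R : realType) (S A : finType)
    (M : mdp R S A) (pi : S -> A -> R) (rho : S -> R) (s : S) :
  is_policy pi -> is_dist rho -> 0 < rho s ->
  0 <= (norm_infty (fun s => (visitation M pi rho s)^-1))^-1 <= 1.
Proof.
move=> hpi hrho rho0; have /andP[g0 g1] := discountP M.
have /andP[v0 v1] := visitation_bounds M hpi s hrho.
have {}v0 : 0 < visitation M pi rho s.
  by apply: lt_le_trans v0; rewrite mulr_gt0 // subr_gt0.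
have D1 : 1 <= norm_infty (fun s => (visitation M pi rho s)^-1).
  apply: le_trans (le_bigmax _ _ s) => /=.
  by rewrite ger0_norm ?invr_ge0 ?(ltW v0) // invf_ge1.
by rewrite invr_ge0 (le_trans ler01 D1) /= invf_le1 // (lt_le_trans ltr01).
Qed.

Theorem theorem4p6 (R : realType) (S A : finType) (M : mdp R S A)
    (hS : nontrivial_states M != finset.set0)
    (mu rho : S -> R)
    (hmu : is_dist mu) (hmu_pos : 0 < min_entry mu)
    (hrho : is_dist rho) (hrho_pos : 0 < min_entry rho)
    (pistar : S -> A -> R) (hpistar : is_optimal M pistar)
    (eta : R) (heta : 0 < eta)
    (pi : nat -> S -> A -> R) (hpi : softmax_pg M (fun _ => eta) mu pi)
    (sigma : R) (hsigma : 0 < sigma < 1) :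
  exists T : nat, forall k : nat, (T <= k)%N ->
    avg rho (Vstar M) - avg rho (V M (pi k)) >=
    k%:R^-1 *
    (min_entry rho ^+ 3 * (1 - sigma) * (1 - discount M)
       / (2 * #|A|%:R ^+ 3)) *
    (norm_infty (fun s => (visitation M pistar rho s)^-1))^-1 *
    (expR (2 * eta / (1 - discount M) ^+ 2) - 1)^-1.
Proof.
have /andP[g0 g1] := discountP M; have /andP[s0 s1] := hsigma.
have [s hs] := set0Pn _ hS.
(* A nontrivial state has an action outside its optimal set, so [A] is inhabited. *)
have A0 : (0 < #|A|)%N.
  move: hs; rewrite inE finset.eqEsubset finset.subsetT /= => /subsetPn[a _ _].
  by apply/card_gt0P; exists a.
pose L := eta / (1 - discount M) ^+ 2.
have L0 : 0 < L by rewrite divr_gt0 // exprn_gt0 // subr_gt0.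
have E0 : 0 < expR (2 * L) - 1 by have := expR_ge1Dx (2 * L); lra.
pose r := min_entry rho.
have r1 : r <= 1 by exact: le_trans (min_entry_le rho s) (dist_entry_le1 s hrho).
pose C := 2 * (expR (2 * L) - 1) / r ^+ 2.
have C0 : 0 < C by rewrite divr_gt0 ?exprn_gt0 // mulr_gt0.
pose c := r * expR (- (2 * L)) * (1 - discount M).
have c0 : 0 < c by rewrite !mulr_gt0 ?expR_gt0 // subr_gt0.
have pol k := softmax_pg_is_positive_policy hmu heta k hpi A0.
have piE k : pi k.+1 = pg_step M eta mu (pi k).
  by apply/funext => s'; apply/funext => a; rewrite hpi.2.
have [||T hT] := quadratic_decrease_rate
  (d := fun k => avg rho (Vstar M) - avg rho (V M (pi k)))
  (fun k => avg_suboptimality_gt0 hrho hpistar (pol k).1 (pol k).2 hrho_pos hS)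
  c0 C0 hsigma.
- move=> k; apply: (avg_suboptimality_ge hrho hpistar (pol k).1 (pol k.+1).1).
  + exact: expR_ge0.
  + exact: ltW.
  + by move=> s' a; rewrite piE; exact: pg_step_ge (pol k).1.
- move=> k.
  have := pg_step_progress_le hmu heta hrho hrho_pos hpistar (pol k).1.
  by rewrite piE -/L -/r -/C; lra.
exists T => k /hT; apply: le_trans.
have rho_s : 0 < rho s by exact: lt_le_trans hrho_pos (min_entry_le rho s).
have /andP[D0 D1] := inv_norm_infty_visitation_bounds M hpistar.1 hrho rho_s.
rewrite -[2 * eta / _]mulrA -/L -/r -!mulrA ler_wpM2l ?invr_ge0 //.
set D := (norm_infty _)^-1 in D0 D1 *; set n := #|A|%:R : R.
have n1 : 1 <= n by rewrite ler1n.
have -> : (1 - sigma) / C = (1 - sigma) * (r ^+ 2 / 2 / (expR (2 * L) - 1)).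
  by rewrite /C; field; rewrite !gt_eqF.
(* The stated constant is the rate [(1 - sigma) / C] times [r * (1 - discount M) * (n ^+ 3)^-1 * D],
   a product of factors in [0, 1]. *)
rewrite [leLHS](_ : _ = (1 - sigma) * (r ^+ 2 / 2 / (expR (2 * L) - 1)) *
    (r * (1 - discount M) * (n ^+ 3)^-1 * D)); last first.
  by field; rewrite !gt_eqF // (lt_le_trans ltr01).
apply: ler_piMr.
  by rewrite mulr_ge0 ?subr_ge0 ?(ltW s1) // !divr_ge0 ?exprn_ge0 // ltW.
have n3 : 0 <= (n ^+ 3)^-1 <= 1.
  have n3 : 1 <= n ^+ 3 by exact: exprn_ege1.
  by rewrite invr_ge0 (le_trans ler01 n3) invf_le1 // (lt_le_trans ltr01).
have /andP[n30 n31] := n3.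
have r0 : 0 <= r := ltW hrho_pos.
by rewrite !mulr_ile1 ?mulr_ge0 //; lra.
Qed.
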